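(* If $D$ and $H$ are Bott equivalent acyclic digraphs, then $D$ and $H$ have the same odd height.
   Context: A digraph $D=(V,E)$ consists of a finite vertex set $V$ and a set $E$ of ordered pairs $(u,v)$ of distinct vertices (arcs). $D$ is acyclic if its vertices can be ordered $v_1,\dots,v_n$ so that $i<j$ for each arc $(v_i,v_j)$. Let $N_D^+(v)=\{w:(v,w)\in E\}$ (out-neighbors) and $N_D^-(v)=\{u:(u,v)\in E\}$ (in-neighbors). The out-degree of $v$ is $|N_D^+(v)|$. Bott equivalence. Local complementation at a vertex $v$: $D*v$ is the digraph obtained from $D$ by toggling (adding if absent, removing if present) the arc $(u,w)$ for each pair $(u,w)\in N_D^-(v)\times N_D^+(v)$ with $u\ne w$. Slide: for two distinct vertices $v,w$ with $N_D^-(v)=N_D^-(w)$, $D\Delta vw$ is the digraph obtained from $D$ by replacing $N_D^+(w)$ by the symmetric difference $N_D^+(w)\Delta N_D^+(v)$. These operations preserve acyclicity. An acyclic digraph $H$ is Bott equivalent to an acyclic digraph $D$ if $H$ is isomorphic to a digraph obtained from $D$ by successively applying (finitely many) local complementations and slides. Odd height. For an acyclic digraph $D$, $L_k(D)$ is the set of vertices $v$ such that a longest directed path of $D$ ending at $v$ has exactly $k$ edges. The odd height of $D$ is the length (number of edges) of a longest directed path ending at a vertex of odd out-degree; equivalently, the maximum $k$ such that $L_k(D)$ contains a vertex of odd out-degree. If $D$ has no vertex of odd out-degree, its odd height is $\infty$. *)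

(* Defs.v *)
From Stdlib Require Import Relations.
From mathcomp Require Import all_boot.

Set Implicit Arguments.
Unset Strict Implicit.
Unset Printing Implicit Defensive.

Record digraph (V : finType) := Digraph {
  arcs : {set V * V};
  arcs_loopless : [forall v, (v, v) \notin arcs] }.

Definition arc (V : finType) (D : digraph V) : rel V :=
  fun u v => (u, v) \in arcs D.

Definition out_nbrs (V : finType) (D : digraph V) (v : V) : {set V} :=
  [set w | arc D v w].

Definition in_nbrs (V : finType) (D : digraph V) (v : V) : {set V} :=
  [set u | arc D u v].

Definition outdeg (V : finType) (D : digraph V) (v : V) : nat :=
  #|out_nbrs D v|.

Definition acyclic (V : finType) (D : digraph V) : Prop :=
  exists s : seq V,
    perm_eq s (enum V) /\ (forall u v, arc D u v -> index u s < index v s).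

Definition symdiff (T : finType) (A B : {set T}) : {set T} :=
  (A :\: B) :|: (B :\: A).

Definition local_compl_arcs (V : finType) (D : digraph V) (v : V) :
    {set V * V} :=
  symdiff (arcs D)
    [set a : V * V | [&& a.1 \in in_nbrs D v, a.2 \in out_nbrs D v
                       & a.1 != a.2]].

Lemma local_compl_loopless (V : finType) (D : digraph V) (v : V) :
  [forall u, (u, u) \notin local_compl_arcs D v].
Proof.
apply/forallP => u; rewrite !inE /= eqxx !andbF /= orbF.
exact: (forallP (arcs_loopless D) u).
Qed.

Definition local_compl (V : finType) (D : digraph V) (v : V) : digraph V :=
  Digraph (local_compl_loopless D v).

Definition slide_arcs (V : finType) (D : digraph V) (v w : V) : {set V * V} :=
  [set a : V * V | if a.1 == w
                   then a.2 \in symdiff (out_nbrs D w) (out_nbrs D v)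
                   else a \in arcs D].

(* The slide creates no loop at w: an arc (v, w) would make v an in-neighbor
   of w, hence of itself. *)
Lemma slide_loopless (V : finType) (D : digraph V) (v w : V) :
  in_nbrs D v = in_nbrs D w -> [forall u, (u, u) \notin slide_arcs D v w].
Proof.
move=> eqN; apply/forallP => u; have loop x := forallP (arcs_loopless D) x.
rewrite inE /=; case: eqP => [-> | _]; last exact: loop.
have Dvw : arc D v w = false.
  by move/setP/(_ v): eqN; rewrite !inE => <-; apply/negbTE/loop.
by rewrite !inE Dvw /= andbF orbF /arc; apply: loop.
Qed.

Definition slide (V : finType) (D : digraph V) (v w : V)
    (eqN : in_nbrs D v = in_nbrs D w) : digraph V :=
  Digraph (slide_loopless eqN).

Inductive bott_step (V : finType) (D : digraph V) : digraph V -> Prop :=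
| Bott_local_compl (v : V) : bott_step D (local_compl D v)
| Bott_slide (v w : V) (eqN : in_nbrs D v = in_nbrs D w) :
    v != w -> bott_step D (slide eqN).

Definition isomorphic (V W : finType) (D : digraph V) (H : digraph W) : Prop :=
  exists2 f : V -> W, bijective f & forall u v, arc H (f u) (f v) = arc D u v.

(* H is Bott equivalent to D; meant for acyclic H and D. *)
Definition bott_equivalent (W V : finType) (H : digraph W) (D : digraph V) :
    Prop :=
  exists2 D' : digraph V,
    clos_refl_trans (digraph V) (@bott_step V) D D' & isomorphic H D'.

Definition has_path_to (V : finType) (D : digraph V) (v : V) (k : nat) : bool :=
  [exists x : V, exists p : k.-tuple V,
    [&& path (arc D) x p, uniq (x :: p) & last x p == v]].

(* Number of edges of a longest directed path ending at v. Vertices on a path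
   are distinct, so its length is less than #|V|. *)
Definition longest_to (V : finType) (D : digraph V) (v : V) : nat :=
  \max_(k < #|V| | has_path_to D v k) k.

(* None stands for infinity. *)
Definition odd_height (V : finType) (D : digraph V) : option nat :=
  if [exists v, odd (outdeg D v)]
  then Some (\max_(v : V | odd (outdeg D v)) longest_to D v)
  else None.

(* Main.v *)
From Stdlib Require Import Relations.
From mathcomp Require Import all_boot.
(* After [all_boot], so that [arc] is not [path.arc]. *)
Require Import Defs.

Set Implicit Arguments.
Unset Strict Implicit.
Unset Printing Implicit Defensive.

(** The level of a vertex (the length of a longest path ending at it) is
    unchanged by both operations. A local complementation at [v] only toggles
    arcs [(u, w)] with [u -> v -> w], which skip at least one level. A slide
    toggles arcs out of [w] towards out-neighbors of [v], which has the same
    level as [w] and keeps its own arcs. As for parities, a slide adds the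
    out-degree of [v] to that of [w] on the same level; a local complementation
    at [v] changes parities only if [v] has odd out-degree, and then only at
    levels strictly below [v], whose own out-degree is unchanged. So the
    highest level with an odd vertex is an invariant. *)

Definition ranking (V : finType) (D : digraph V) (r : V -> nat) : Prop :=
  forall x y, arc D x y -> r x < r y.

(** A local description that determines [longest_to D], so that levels can be followed through the
    operations without handling paths. *)
Definition level_function (V : finType) (D : digraph V) (l : V -> nat) : Prop :=
  ranking D l /\
  forall y, 0 < l y -> exists2 x, arc D x y & l y = (l x).+1.

Lemma acyclic_ranking (V : finType) (D : digraph V) :
  acyclic D -> exists r, ranking D r.
Proof. by case=> s [_ Hs]; exists (fun v => index v s). Qed.

Section Levels.
Variables (V : finType) (D : digraph V).

Lemma ranking_path_uniq (r : V -> nat) (x : V) (p : seq V) :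
  ranking D r -> path (arc D) x p -> uniq (x :: p).
Proof.
move=> rD Hp; apply: (map_uniq (f := r)).
apply: (sorted_uniq ltn_trans ltnn).
by rewrite /= path_map; apply: sub_path Hp => u v; apply: rD.
Qed.

Lemma ranking_path_le_longest (r : V -> nat) (x : V) (p : seq V) :
  ranking D r -> path (arc D) x p -> size p <= longest_to D (last x p).
Proof.
move=> rD Hp; have Up := ranking_path_uniq rD Hp.
(* A path without repetition has fewer edges than [#|V|], so its length lies in the index range of
   the maximum. *)
have lt_pV : size p < #|V| by rewrite -[(size p).+1](card_uniqP Up) max_card.
apply: (leq_bigmax_cond (Ordinal lt_pV)).
apply/existsP; exists x; apply/existsP; exists (in_tuple p).
by rewrite Hp Up eqxx.
Qed.

Lemma longest_toP (v : V) :
  exists x p, [/\ path (arc D) x p, last x p = v & size p = longest_to D v].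
Proof.
have V_gt0 : 0 < #|V| by apply/card_gt0P; exists v.
(* The empty path at [v] makes the maximum range over a nonempty set, hence it is attained. *)
have P0 : has_path_to D v (Ordinal V_gt0).
  apply/existsP; exists v; apply/existsP; exists [tuple]; exact: eqxx.
have [k Pk ->] : {k : 'I_#|V| | has_path_to D v k & longest_to D v = k}.
  by apply: eq_bigmax_cond; apply/card_gt0P; exists (Ordinal V_gt0).
have /existsP[x /existsP[p /and3P[Hp _ /eqP Ep]]] := Pk.
by exists x, p; rewrite size_tuple.
Qed.

(** Appending an arc to a longest path gives strict growth; deleting the last vertex of a longest
    path to [y] gives a predecessor exactly one level below. *)
Lemma longest_to_level (r : V -> nat) :
  ranking D r -> level_function D (longest_to D).
Proof.
move=> rD.
have incr : ranking D (longest_to D).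
  move=> x y Dxy; have [z [p [Hp Ep <-]]] := longest_toP x.
  have Hpy : path (arc D) z (rcons p y) by rewrite rcons_path Hp Ep.
  by have := ranking_path_le_longest rD Hpy; rewrite last_rcons size_rcons.
split=> // y; have [z [p]] := longest_toP y.
case/lastP: p => [[_ _ <-] // | p y' []].
rewrite rcons_path last_rcons size_rcons => /andP[Hp Dy] Ey' Ep _.
rewrite {y'}Ey' in Dy; exists (last z p) => //; apply/eqP.
by rewrite eqn_leq incr // andbT -Ep ltnS (ranking_path_le_longest rD).
Qed.

(** Going back from [v] through predecessors, [l] drops by exactly one at each arc and [r] by at
    least one. So a level function is the least ranking. *)
Lemma level_le_ranking (l r : V -> nat) (v : V) :
  level_function D l -> ranking D r -> l v <= r v.
Proof.
move=> [_ predD] rD; move Ev: (l v) => n; elim: n v Ev => // n IHn v Ev.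
have [|x Dxv] := predD v; first by rewrite Ev.
rewrite Ev => -[/esym/IHn le_nx]; exact: leq_ltn_trans le_nx (rD _ _ Dxv).
Qed.

Lemma longest_toE (l : V -> nat) : level_function D l -> longest_to D =1 l.
Proof.
move=> lD v; have [rD _] := lD; have LD := longest_to_level rD.
by apply/eqP; rewrite eqn_leq !level_le_ranking //; case: LD.
Qed.

End Levels.

(** The odd vertices need not correspond: mutual domination of their levels equates the maxima, and
    also makes the infinite cases coincide. *)
Lemma odd_height_eq (V W : finType) (D : digraph V) (H : digraph W) :
    (forall v, odd (outdeg D v) ->
       exists2 w, odd (outdeg H w) & longest_to D v <= longest_to H w) ->
    (forall w, odd (outdeg H w) ->
       exists2 v, odd (outdeg D v) & longest_to H w <= longest_to D v) ->
  odd_height D = odd_height H.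
Proof.
move=> DH HD; rewrite /odd_height.
have -> : [exists v, odd (outdeg D v)] = [exists w, odd (outdeg H w)].
  apply/existsP/existsP => [[v /DH[w]] | [w /HD[v]]]; first by exists w.
  by exists v.
case: ifP => // _; congr Some; apply/eqP; rewrite eqn_leq.
apply/andP; split; apply/bigmax_leqP.
  by move=> v /DH[w odd_w le_vw]; apply: (bigmax_sup w).
by move=> w /HD[v odd_v le_wv]; apply: (bigmax_sup v).
Qed.

Lemma isomorphic_odd_height (V W : finType) (D : digraph V) (H : digraph W)
    (l : W -> nat) :
  isomorphic D H -> level_function H l -> odd_height D = odd_height H.
Proof.
case=> f bij_f arcf lH; have [g fK gK] := bij_f.
have lD : level_function D (l \o f).
  split=> [x y Dxy | y /lH.2[x Hx /= ->]]; first by apply: lH.1; rewrite arcf.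
  by exists (g x); rewrite /= ?gK // -arcf gK.
have outf v : outdeg H (f v) = outdeg D v.
  rewrite /outdeg -(on_card_preimset (f := f)); last exact: onW_bij.
  by apply: eq_card => x; rewrite !inE arcf.
apply: odd_height_eq => [v odd_v | w odd_w].
  by exists (f v); rewrite ?outf // (longest_toE lD) (longest_toE lH).
exists (g w); first by rewrite -outf gK.
by rewrite (longest_toE lD) (longest_toE lH) /= gK.
Qed.

Lemma in_symdiff (T : finType) (A B : {set T}) (x : T) :
  (x \in symdiff A B) = (x \in A) (+) (x \in B).
Proof. by rewrite !inE; case: (x \in A); case: (x \in B). Qed.

Lemma odd_card_symdiff (T : finType) (A B : {set T}) :
  odd #|symdiff A B| = odd #|A| (+) odd #|B|.
Proof.
have disj : [disjoint A :\: B & B :\: A].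
  rewrite -setI_eq0; apply/eqP/setP => x.
  by rewrite !inE; case: (x \in A); case: (x \in B).
have := leq_card_setU (A :\: B) (B :\: A); rewrite disj => -[_ /eqP cardU].
rewrite /symdiff cardU -(cardsID B A) -(cardsID A B) (setIC B A) !oddD.
by case: (odd _); case: (odd _); case: (odd _).
Qed.

Section Operations.
Variables (V : finType) (D : digraph V) (l : V -> nat).
Hypothesis lD : level_function D l.

(** The condition that the endpoints differ disappears, since [l] rules out a cycle through [x] and
    [v]. *)
Lemma arc_local_compl (v x y : V) :
  arc (local_compl D v) x y = arc D x y (+) (arc D x v && arc D v y).
Proof.
rewrite /arc in_symdiff inE /= !inE; case: eqVneq => [<- | _].
  case: (boolP (arc D x v && arc D v x)) => [/andP[xv vx] | _].
    by have := ltn_trans (lD.1 _ _ xv) (lD.1 _ _ vx); rewrite ltnn.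
  by rewrite !andbF.
by rewrite andbT.
Qed.

Lemma local_compl_level (v : V) : level_function (local_compl D v) l.
Proof.
case: (lD) => rD predD; split=> [x y | y /predD[x Dxy Ey]].
  rewrite arc_local_compl; case: (boolP (arc D x y)) => [/rD // | _].
  by case/andP=> /rD lt_xv /rD; apply: ltn_trans.
(* An arc rising by one level is never toggled, as [v] would lie strictly between its ends. *)
exists x => //; rewrite arc_local_compl Dxy; apply/negP => /andP[/rD lt_xv /rD].
by rewrite Ey ltnS leqNgt lt_xv.
Qed.

Lemma odd_outdeg_local_compl (v x : V) :
  odd (outdeg (local_compl D v) x)
    = odd (outdeg D x) (+) (arc D x v && odd (outdeg D v)).
Proof.
have -> : outdeg (local_compl D v) x =
    #|symdiff (out_nbrs D x) (if arc D x v then out_nbrs D v else set0)|.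
  apply: eq_card => y; rewrite inE arc_local_compl in_symdiff inE.
  by case: (arc D x v); rewrite inE.
by rewrite odd_card_symdiff; case: (arc D x v); rewrite ?cards0.
Qed.

Lemma local_compl_odd_height (v : V) :
  odd_height D = odd_height (local_compl D v).
Proof.
have rD := lD.1; have lD' := local_compl_level v.
have odd_v : odd (outdeg (local_compl D v) v) = odd (outdeg D v).
  rewrite odd_outdeg_local_compl; case: (boolP (arc D v v)) => [/rD|_].
    by rewrite ltnn.
  by rewrite addbF.
apply: odd_height_eq => x odd_x.
  have [/andP[/rD lt_xv odd_Dv] | nxv] :=
    boolP (arc D x v && odd (outdeg D v)).
    (* If the parity of [x] flips, [v] is a higher vertex that is odd before and after. *)
    by exists v; rewrite ?odd_v // (longest_toE lD) (longest_toE lD') ltnW.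
  exists x; first by rewrite odd_outdeg_local_compl odd_x (negbTE nxv).
  by rewrite (longest_toE lD) (longest_toE lD').
have [/andP[/rD lt_xv odd_Dv] | nxv] :=
  boolP (arc D x v && odd (outdeg D v)).
  by exists v => //; rewrite (longest_toE lD) (longest_toE lD') ltnW.
move: odd_x; rewrite odd_outdeg_local_compl (negbTE nxv) addbF.
by exists x => //; rewrite (longest_toE lD) (longest_toE lD').
Qed.

Variables v w : V.
Hypothesis eqN : in_nbrs D v = in_nbrs D w.
Hypothesis neq_vw : v != w.

Lemma arc_slide (x y : V) :
  arc (slide eqN) x y = arc D x y (+) ((x == w) && arc D v y).
Proof.
rewrite /arc inE /=; case: eqVneq => [-> | _]; last by rewrite addbF.
by rewrite in_symdiff !inE.
Qed.

(** A predecessor of [a] one level below it is also an in-neighbor of [b]. *)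
Lemma level_in_nbrs_le (a b : V) : in_nbrs D a = in_nbrs D b -> l a <= l b.
Proof.
move/setP => eqab; case: (posnP (l a)) => [-> // | /lD.2[x Dxa ->]].
by apply: lD.1; have := eqab x; rewrite !inE Dxa.
Qed.

Lemma level_in_nbrs : l v = l w.
Proof. by apply/eqP; rewrite eqn_leq !level_in_nbrs_le. Qed.

Lemma slide_level : level_function (slide eqN) l.
Proof.
case: (lD) => rD predD; split=> [x y | y /predD[x Dxy Ey]].
  rewrite arc_slide; case: (boolP (arc D x y)) => [/rD // | _].
  by case/andP=> /eqP-> /rD; rewrite level_in_nbrs.
have [/andP[/eqP xw Dvy] | nxw] := boolP ((x == w) && arc D v y).
  (* The slide removes the arc from [w] to [y]; [v], on the same level, keeps its own arc to [y] and
     replaces [w]. *)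
  exists v; last by rewrite level_in_nbrs -xw.
  by rewrite arc_slide (negbTE neq_vw) Dvy.
by exists x; rewrite // arc_slide Dxy (negbTE nxw).
Qed.

Lemma odd_outdeg_slide (x : V) :
  odd (outdeg (slide eqN) x)
    = odd (outdeg D x) (+) ((x == w) && odd (outdeg D v)).
Proof.
have -> : outdeg (slide eqN) x =
    #|symdiff (out_nbrs D x) (if x == w then out_nbrs D v else set0)|.
  apply: eq_card => y; rewrite inE arc_slide in_symdiff inE.
  by case: (x == w); rewrite inE.
by rewrite odd_card_symdiff; case: (x == w); rewrite ?cards0.
Qed.

Lemma slide_odd_height : odd_height D = odd_height (slide eqN).
Proof.
have lD' := slide_level.
have odd_v : odd (outdeg (slide eqN) v) = odd (outdeg D v).
  by rewrite odd_outdeg_slide (negbTE neq_vw) addbF.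
apply: odd_height_eq => x odd_x.
  have [/andP[/eqP xw odd_Dv] | nxw] := boolP ((x == w) && odd (outdeg D v)).
    exists v; rewrite ?odd_v // (longest_toE lD) (longest_toE lD').
    by rewrite xw level_in_nbrs.
  exists x; first by rewrite odd_outdeg_slide odd_x (negbTE nxw).
  by rewrite (longest_toE lD) (longest_toE lD').
have [/andP[/eqP xw odd_Dv] | nxw] := boolP ((x == w) && odd (outdeg D v)).
  exists v => //; rewrite (longest_toE lD) (longest_toE lD').
  by rewrite xw level_in_nbrs.
move: odd_x; rewrite odd_outdeg_slide (negbTE nxw) addbF.
by exists x => //; rewrite (longest_toE lD) (longest_toE lD').
Qed.

End Operations.

(** The same [l] is carried along the induction: it witnesses the acyclicity of every intermediate
    digraph. *)
Lemma bott_steps_odd_height (V : finType) (D D' : digraph V) (l : V -> nat) :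
    clos_refl_trans (digraph V) (@bott_step V) D D' ->
  level_function D l -> level_function D' l /\ odd_height D = odd_height D'.
Proof.
elim=> {D D'} [D _ [v | v w eqN neq_vw] lD | D lD | D1 D2 D3 _ IH12 _ IH23 lD1].
- split; [exact: local_compl_level | exact: (local_compl_odd_height lD)].
- split; [exact: slide_level | exact: (slide_odd_height lD)].
- by [].
by have [/IH23[lD3 <-] ->] := IH12 lD1.
Qed.

Theorem proposition5p5 (V W : finType) (D : digraph V) (H : digraph W)
    (acyclicD : acyclic D) (acyclicH : acyclic H)
    (HD : bott_equivalent H D) :
  odd_height D = odd_height H.
Proof.
have [r /longest_to_level lD] := acyclic_ranking acyclicD.
have [D' stepsDD' isoHD'] := HD.
have [lD' ->] := bott_steps_odd_height stepsDD' lD.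
by rewrite (isomorphic_odd_height isoHD' lD').
Qed.
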